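(* Consider a single marble multi-urn search problem. A block policy $\mathbf u_B=(v^1,v^2,\dots,v^{|\mathcal V|})$ is an optimal policy if and only if $$\frac{\varphi_{v^i}}{N_{v^i}}\ge\frac{\varphi_{v^{i+1}}}{N_{v^{i+1}}},\qquad i=1,2,\dots,|\mathcal V|-1.$$
   Context: Multi-urn search problem. Let $\mathcal V$ be a finite nonempty set of urns. Urn $i\in\mathcal V$ contains $N_i\ge 1$ marbles ($N_i$ a known integer), at most one of which is red; all other marbles are blue. Let $A_i$ be the event that urn $i$ contains a red marble. For $U\subseteq\mathcal V$ put $\varphi_U=\mathbb P(\bigcap_{i\in U}A_i)$, with $\varphi_\emptyset=1$ and $\varphi_i=\varphi_{\{i\}}$; it is assumed that $\varphi_i>0$ for all $i$. Marbles are drawn from each urn in uniformly random order without replacement: given which urns contain a red marble, the position of the red marble in the draw order of each such urn $i$ is uniform on $\{1,\dots,N_i\}$, and these positions are independent across urns. The problem is a single marble problem if $\varphi_U=0$ for every $U\subseteq\mathcal V$ with $|U|>1$ (so $\sum_{i\in\mathcal V}\varphi_i\le 1$, with strict inequality allowed). Let $N=\sum_{i\in\mathcal V}N_i$. A valid policy is a sequence $\mathbf u=(u(0),\dots,u(N-1))$ of elements of $\mathcal V$ with $|\{t:u(t)=i\}|=N_i$ for every $i\in\mathcal V$. The search following $\mathbf u$ draws, at each stage $t=0,1,\dots$, one marble from urn $u(t)$, discards it if it is blue, and stops as soon as a red marble is drawn or all urns are empty. The cost $C\in\{0,1,\dots,N\}$ is the number of blue marbles drawn in the search (so $C=N$ if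 there is no red marble). A valid policy is optimal if it minimizes $\mathbb E[C]$ over all valid policies. A block policy, written $\mathbf u_B=(v^1,\dots,v^{|\mathcal V|})$ with $(v^1,\dots,v^{|\mathcal V|})$ an ordering of the urns in $\mathcal V$, is the valid policy in which each urn is queried exhaustively before the next one: $u(t)=v^i$ whenever $\sum_{j=1}^{i-1}N_{v^j}\le t<\sum_{j=1}^{i}N_{v^j}$. *)

(* Defs.v *)
From HB Require Import structures.
From mathcomp Require Import all_boot all_order all_algebra.
From mathcomp Require Import all_classical all_reals all_analysis.

Set Implicit Arguments.
Unset Strict Implicit.
Unset Printing Implicit Defensive.

Import Order.TTheory GRing.Theory Num.Theory.
Local Open Scope classical_set_scope.
Local Open Scope ring_scope.

Definition joint_prob d (T : measurableType d) (R : realType)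
    (P : probability T R) (V : finType) (A : V -> set T) (U : {set V}) : R :=
  fine (P (\bigcap_(i in [set` U]) A i)).

Definition exactly_red (T : Type) (V : finType) (A : V -> set T)
    (D : {set V}) : set T :=
  [set w | forall i, A i w <-> i \in D].

(* [redpos i w] is the rank, counted from 1, of the red marble in the draw
   order of urn [i]; its value carries no information when [w] is outside
   [hasred i].  [redpos_law] says that, given that the urns containing a red
   marble are exactly those of [D], the ranks of the red marbles of these urns
   are independent and uniform.  It is multiplied out by the probability of
   the conditioning event so as to cover the case where that is zero. *)
Record urn_search d (T : measurableType d) (R : realType)
    (P : probability T R) (V : finType) := UrnSearch {
  marbles : V -> nat;
  hasred : V -> set T;
  redpos : V -> T -> nat;
  urns_nonempty : (0 < #|V|)%N;
  marbles_gt0 : forall i, (0 < marbles i)%N;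
  measurable_hasred : forall i, measurable (hasred i);
  measurable_redpos : forall i, measurable_fun (hasred i) (redpos i);
  redpos_range : forall i w, hasred i w -> (1 <= redpos i w <= marbles i)%N;
  redpos_law : forall (D : {set V}) (k : V -> nat),
    (forall i, i \in D -> (1 <= k i <= marbles i)%N) ->
    P (exactly_red hasred D `&` [set w | forall i, i \in D -> redpos i w = k i])
    = (P (exactly_red hasred D) * (\prod_(i in D) (marbles i)%:R^-1)%:E)%E;
  hasred_gt0 : forall i, 0 < joint_prob P hasred [set i]%SET }.

Section Search.
Context d (T : measurableType d) (R : realType) (P : probability T R)
  (V : finType).
Implicit Types (Q : urn_search P V) (U : {set V}) (i : V) (u v : seq V).

Definition phi Q U : R := joint_prob P (hasred Q) U.

Definition single_marble Q := forall U, (1 < #|U|)%N -> phi Q U = 0.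

Definition valid_policy Q u :=
  size u = (\sum_i marbles Q i)%N /\ forall i, count_mem i u = marbles Q i.

(* the [k]-th marble (counted from 1) drawn from urn [i] is red *)
Definition is_red Q (w : T) i (k : nat) : bool :=
  `[< hasred Q i w >] && (redpos Q i w == k).

(* [past] is the sequence of the urns queried so far; the result is the number
   of blue marbles drawn from then on. *)
Fixpoint cost_from Q (w : T) (past u : seq V) : nat :=
  if u is i :: u' then
    if is_red Q w i (count_mem i past).+1 then 0%N
    else (cost_from Q w (i :: past) u').+1
  else 0%N.

Definition cost Q u (w : T) : R := (cost_from Q w [::] u)%:R.

Definition optimal Q u :=
  valid_policy Q u /\
  forall u', valid_policy Q u' -> ('E_P[cost Q u] <= 'E_P[cost Q u'])%E.

Definition block_policy Q v : seq V :=
  flatten [seq nseq (marbles Q i) i | i <- v].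

End Search.

(* Main.v *)
Require Import Defs.
From HB Require Import structures.
From mathcomp Require Import all_boot all_order all_algebra.
From mathcomp Require Import all_classical all_reals all_analysis.
From mathcomp Require Import measurable_realfun.
From mathcomp Require Import lra ring zify.

Set Implicit Arguments.
Unset Strict Implicit.
Unset Printing Implicit Defensive.

Import Order.TTheory GRing.Theory Num.Theory.
Local Open Scope ring_scope.

(** The cost is linear in the order of the draws. Let the density of an urn be
    [phi_i / N_i]. Almost surely at most one urn contains a red marble, so each
    stage of a valid policy meets a red marble with probability the density of
    the urn queried at that stage, and these events exclude one another. A red
    marble met when [k] stages remain, the current one included, spares
    exactly [k] blue draws out of [N]. Hence ([expected_cost])

      [E[C] = N - (sum over the stages of (stages remaining) * density)].

    All valid policies list the urns with the same multiplicities, so an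
    optimal one maximizes a weighted sum with decreasing weights over the
    rearrangements of a fixed list. By the exchange argument the maximizers are
    exactly the lists with nonincreasing densities: moving a large density
    forward never loses ([saving_sorted_max]), and in a maximizer a swap of two
    neighbours cannot gain ([saving_max_sorted]). This characterizes the optimal
    valid policies, blocks or not ([optimal_sorted]).

    A block policy repeats each urn a positive number of times, and repetitions
    are harmless for a reflexive order; its densities are therefore
    nonincreasing if and only if those of consecutive blocks are
    ([sorted_flatten_nseq]). *)

(** * Maximizing a sum with decreasing weights over rearrangements *)

Section WeightedSum.
Context (R : realDomainType) (V : eqType) (r : V -> R).
Implicit Types (s t : seq V) (a b : V).

(** The weight of an entry is the number of entries from it to the end. *)
Fixpoint saving s : R :=
  if s is a :: s' then (size s)%:R * r a + saving s' else 0.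

Lemma saving_cat_swap s a b t :
  saving (s ++ [:: a, b & t]) = saving (s ++ [:: b, a & t]) + (r a - r b).
Proof.
elim: s => [|c s IHs] /=; last by rewrite IHs !size_cat /=; ring.
by rewrite -[(size t).+2]addn1 natrD; ring.
Qed.

(** Moving [a] to the right across [s] costs [r a] once for each entry of [s]
    and gains the value of that entry, which is at least [r a]. *)
Lemma saving_insert a s t : all (fun b => r a <= r b) s ->
  saving (a :: s ++ t) <= saving (s ++ a :: t).
Proof.
elim: s => [//|b s IHs] /andP[le_ab /IHs {}IHs].
rewrite -[a :: _]cat0s -[(b :: s) ++ t]/(b :: (s ++ t)) saving_cat_swap /=.
rewrite !size_cat /= !addnS -addrA lerD2l.
by move: IHs; rewrite /= size_cat; lra.
Qed.

(** Induction on the rearrangement [t]: its head can be removed from [s] as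
    well, which leaves a sorted list, and putting it back at its place in the
    sorted order is at least as good as putting it in front. *)
Lemma saving_sorted_max s t : sorted (fun a b => r b <= r a) s ->
  perm_eq s t -> saving t <= saving s.
Proof.
elim: t s => [|a t IHt] s s_sorted eq_st; first by move: eq_st => /perm_nilP ->.
have /splitPr s_split : a \in s by rewrite (perm_mem eq_st) mem_head.
case: s_split eq_st s_sorted => s1 s2.
rewrite perm_catC cat_cons perm_cons perm_catC => eq_st s_sorted.
have ge_trans : transitive (fun a b => r b <= r a).
  by move=> y x z le_yx le_zy; apply: le_trans le_yx.
apply: le_trans (saving_insert s2 _); last first.
  move: s_sorted; rewrite (sorted_pairwise ge_trans) pairwise_cat.
  by rewrite allrel_consr => /and3P[/andP[]].
rewrite /= -(perm_size eq_st) lerD2l IHt //.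
by apply: subseq_sorted s_sorted => //; rewrite cat_subseq ?subseq_cons.
Qed.

(** A descent at two neighbours would be improved by swapping them. *)
Lemma saving_max_sorted s :
  (forall t, perm_eq s t -> saving t <= saving s) ->
  sorted (fun a b => r b <= r a) s.
Proof.
case: s => [//|a0 s] s_max; apply/(sortedP a0) => k lt_k.
have def_s : a0 :: s = take k (a0 :: s) ++
    [:: nth a0 (a0 :: s) k, nth a0 (a0 :: s) k.+1 & drop k.+2 (a0 :: s)].
  by rewrite -drop_nth // -drop_nth 1?ltnW // cat_take_drop.
set t := drop _ _ in def_s; set p := take _ _ in def_s.
set a := nth _ _ k in def_s *; set b := nth _ _ k.+1 in def_s *.
have := s_max (p ++ [:: b, a & t]); rewrite [in perm_eq _]def_s perm_cat2l.
rewrite -[[:: a, b & t]]/([:: a; b] ++ t) -[[:: b, a & t]]/([:: b; a] ++ t).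
rewrite perm_cat2r (perm_catC [:: a] [:: b]) => /(_ (perm_refl _)).
by rewrite [in saving (a0 :: _)]def_s /= saving_cat_swap; lra.
Qed.

End WeightedSum.

(** Comparisons inside a block hold by reflexivity; what remains are those
    between consecutive blocks, as no block is empty. *)
Lemma sorted_flatten_nseq (V : Type) (e : rel V) (n : V -> nat) (s : seq V) :
  reflexive e -> (forall i, 0 < n i)%N ->
  sorted e (flatten [seq nseq (n i) i | i <- s]) = sorted e s.
Proof.
move=> e_refl n_gt0.
have path_nseq i k t : path e i (nseq k i ++ t) = path e i t.
  by elim: k => //= k ->; rewrite e_refl.
case: s => //= i s; case: (n i) (n_gt0 i) => //= k _; rewrite path_nseq.
elim: s i => //= j s IHs i.
by case: (n j) (n_gt0 j) => //= m _; rewrite path_nseq IHs.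
Qed.

(** * The expected cost of a valid policy *)

Section Search.
Local Open Scope classical_set_scope.

Lemma ae_measure_eq d (T : measurableType d) (R : realType)
    (mu : {measure set T -> \bar R}) (X Y : set T) :
  measurable X -> measurable Y ->
  {ae mu, forall w, X w <-> Y w} -> mu X = mu Y.
Proof.
move=> mX mY eqXY; rewrite -(setIT X) -(setIT Y) -!integral_indic //.
apply: ae_eq_integral => //; try by apply/measurable_EFinP/measurable_indic.
apply: filterS eqXY => w eqXYw _; congr _%:E.
by rewrite !indicE; congr (_ : bool)%:R; apply/idP/idP; rewrite !inE; move/eqXYw.
Qed.

Context d (T : measurableType d) (R : realType) (P : probability T R)
  (V : finType) (Q : urn_search P V).
Implicit Types (w : T) (i j : V) (u past : seq V).

Definition density i : R := phi Q [set i]%SET / (marbles Q i)%:R.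

Definition at_most_one_red w := forall i j, hasred Q i w -> hasred Q j w -> i = j.

Definition red_event i k : set T := [set w | is_red Q w i k].

(** The indicators are taken at all stages, even after a red marble has been
    found, so that this quantity is linear in the events [red_event i k]; the
    cost itself is not. *)
Fixpoint stages_saved w past u : R :=
  if u is i :: u' then
    (size u)%:R * \1_(red_event i (count_mem i past).+1) w
      + stages_saved w (i :: past) u'
  else 0.

Lemma stages_saved_ge0 w past u : 0 <= stages_saved w past u.
Proof.
elim: u past => [|i u IHu] past //=.
by rewrite addr_ge0 ?mulr_ge0 // indicE.
Qed.

(** Once the only red marble has been drawn, the later indicators vanish: they
    concern other urns or later ranks. *)
Lemma stages_saved_after_red w past u i : at_most_one_red w ->
  hasred Q i w -> (redpos Q i w <= count_mem i past)%N ->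
  stages_saved w past u = 0.
Proof.
move=> one_red red_i; elim: u past => [|j u IHu] past le_pos //=.
rewrite IHu /=; last exact: leq_trans (leq_addl _ _).
rewrite indicE memNset ?mulr0 ?addr0 //= => /andP[/asboolP red_j /eqP pos_j].
move: le_pos; rewrite -(one_red _ _ red_j red_i) in pos_j *.
by rewrite pos_j ltnn.
Qed.

(** The pointwise form of the formula for the expected cost. It can fail when two
    urns contain a red marble, as each of them then counts as a saving. *)
Lemma cost_add_saved w past u : at_most_one_red w ->
  (cost_from Q w past u)%:R + stages_saved w past u = (size u)%:R.
Proof.
move=> one_red; elim: u past => [|i u IHu] past /=; first by rewrite addr0.
rewrite indicE; case: ifPn => [red_i|blue_i].
  rewrite mem_set // mulr1 add0r.
  have /andP[/asboolP hasred_i /eqP pos_i] := red_i.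
  by rewrite (stages_saved_after_red _ one_red hasred_i) ?addr0 //= eqxx pos_i.
rewrite memNset; last exact/negP.
by rewrite mulr0 add0r -[in LHS]natr1 addrAC IHu natr1.
Qed.

Lemma measurable_red_event i k : measurable (red_event i k).
Proof.
have -> : red_event i k = hasred Q i `&` redpos Q i @^-1` [set k].
  apply/seteqP; split=> w /=.
    by move=> /andP[/asboolP ? /eqP].
  by move=> [? ?]; apply/andP; split; [apply/asboolP|apply/eqP].
by apply: measurable_redpos => //; exact: measurable_hasred.
Qed.

Lemma measurable_cost past u :
  measurable_fun setT (fun w => (cost_from Q w past u)%:R : R).
Proof.
elim: u past => [|i u IHu] past /=; first exact: measurable_cst.
have -> : (fun w => (if is_red Q w i (count_mem i past).+1 then 0%N
    else (cost_from Q w (i :: past) u).+1)%:R : R) =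
  fun w => if is_red Q w i (count_mem i past).+1 then 0 else
    1 + (cost_from Q w (i :: past) u)%:R.
  by apply/funext => w; case: ifP => // _; rewrite nat1r.
apply: measurable_fun_ifT; [|exact: measurable_cst|exact: measurable_funD].
apply: (measurable_fun_bool true); rewrite setTI.
exact: measurable_red_event.
Qed.

Lemma measurable_stages_saved past u :
  measurable_fun setT (fun w => stages_saved w past u).
Proof.
elim: u past => [|i u IHu] past /=; first exact: measurable_cst.
apply: measurable_funD => //; apply: measurable_funM => //.
exact/measurable_indic/measurable_red_event.
Qed.

Lemma measurable_exactly_red (D : {set V}) :
  measurable (exactly_red (hasred Q) D).
Proof.
have -> : exactly_red (hasred Q) D =
  \bigcap_(i in [set: V]) (if i \in D then hasred Q i else ~` hasred Q i).
  apply/seteqP; split=> w /=.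
    by move=> h i _; case: ifPn => [/h //|/negP iD /h].
  move=> h i; have := h i Logic.I; case: ifPn => [//|_ nred].
  by split => // /nred.
apply: fin_bigcap_measurable; first exact: finite_finset.
move=> i _; case: ifP => _; last apply: measurableC; exact: measurable_hasred.
Qed.

Section SingleMarble.
Hypothesis single : single_marble Q.

(** Two distinct urns are both red with probability zero, and there are finitely
    many pairs of urns. *)
Lemma ae_at_most_one_red : {ae P, forall w, at_most_one_red w}.
Proof.
apply: filter_forall => i; apply: filter_forall => j.
have [->|neq_ij] := eqVneq i j; first exact: aeW.
have mA k : measurable (hasred Q k) by exact: measurable_hasred.
exists (hasred Q i `&` hasred Q j); split; first exact: measurableI.
  have := single (U := [set i; j]%SET).
  rewrite cards2 neq_ij => /(_ isT).
  rewrite /phi /joint_prob => /eqP; rewrite fine_eq0 ?fin_num_measure //.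
    move/eqP => /= P0; rewrite -[RHS]P0; congr (P _).
    apply/seteqP; split=> w /=.
      by move=> [? ?] k /=; rewrite !inE => /orP[] /eqP ->.
    by move=> h; split; apply: h; rewrite /= !inE eqxx ?orbT.
  by apply: fin_bigcap_measurable => //; exact: finite_finset.
move=> w /= /not_implyP[red_i /not_implyP[red_j _]]; split => //.
Qed.

(** The law of the ranks is given conditionally on the exact set of red urns;
    almost surely, urn [i] is red if and only if that set is [{i}]. *)
Lemma prob_red_event i k : (1 <= k <= marbles Q i)%N ->
  P (red_event i k) = (density i)%:E.
Proof.
move=> k_range; pose E := exactly_red (hasred Q) [set i]%SET.
have mE : measurable E := measurable_exactly_red _.
have ae_E : {ae P, forall w, hasred Q i w <-> E w}.
  apply: filterS ae_at_most_one_red => w one_red; split; last first.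
    by move=> h; apply/h; rewrite inE.
  move=> red_i j; rewrite inE; split=> [red_j|/eqP -> //].
  by rewrite (one_red _ _ red_i red_j).
have PE : P E = (phi Q [set i]%SET)%:E.
  have -> : phi Q [set i]%SET = fine (P (hasred Q i)).
    rewrite /phi /joint_prob; congr (fine (P _)).
    apply/seteqP; split=> w /=; first by apply; rewrite /= inE.
    by move=> red_i j /=; rewrite inE => /eqP ->.
  rewrite fineK ?fin_num_measure //.
    by apply: esym; apply: ae_measure_eq => //; exact: measurable_hasred.
  exact: measurable_hasred.
have := @redpos_law _ _ _ _ _ Q [set i]%SET (fun=> k).
rewrite big_set1 -/E PE -EFinM -/(density i) => <-; last first.
  by move=> j; rewrite inE => /eqP ->.
have eq_red w : E w -> red_event i k w <->
    forall j, j \in [set i]%SET -> redpos Q j w = k.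
  move=> Ew; split=> [/andP[_ /eqP pos_i] j|h]; first by rewrite inE => /eqP ->.
  by apply/andP; split; [apply/asboolP/Ew; rewrite inE|apply/eqP/h; rewrite inE].
have -> : E `&` [set w | forall j, j \in [set i]%SET -> redpos Q j w = k] =
    E `&` red_event i k.
  by apply/seteqP; split=> w /= [Ew h]; split=> //; apply/eq_red.
have mred := measurable_red_event i k.
apply: ae_measure_eq => //; first exact: measurableI.
apply: filterS ae_E => w h; split=> [red|[]//]; split=> //.
by apply/h/asboolP; have /andP[] := red.
Qed.

(** The bound on the multiplicities keeps every rank within the range where it
    is uniformly distributed. *)
Lemma integral_stages_saved past u :
  (forall i, count_mem i past + count_mem i u <= marbles Q i)%N ->
  (\int[P]_w (stages_saved w past u)%:E = (saving density u)%:E)%E.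
Proof.
elim: u past => [|i u IHu] past le_n /=; first by rewrite integral0_eq.
under eq_integral do rewrite EFinD EFinM.
rewrite ge0_integralD //; first last.
- exact/measurable_EFinP/measurable_stages_saved.
- by move=> w _; rewrite lee_fin stages_saved_ge0.
- apply/measurable_EFinP/measurable_funM => //.
  exact/measurable_indic/measurable_red_event.
rewrite IHu; last first.
  by move=> j; have := le_n j; rewrite /= addnCA addnA.
rewrite ge0_integralZl_EFin //; last first.
  exact/measurable_EFinP/measurable_indic/measurable_red_event.
rewrite integral_indic // ?setIT; last exact: measurable_red_event.
rewrite [X in (_ * X)%E](_ : _ = (density i)%:E).
  by rewrite EFinD EFinM.
apply: prob_red_event => /=.
apply: leq_trans (le_n i); rewrite /= eqxx; lia.
Qed.

Lemma expected_cost u : valid_policy Q u ->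
  ('E_P[cost Q u] = ((size u)%:R - saving density u)%:E)%E.
Proof.
move=> [_ count_u]; rewrite unlock.
have saved_u : (\int[P]_w (stages_saved w [::] u)%:E = (saving density u)%:E)%E.
  by apply: integral_stages_saved => i; rewrite count_u.
rewrite EFinB; apply/eqP; rewrite eq_sym sube_eq ?fin_num_adde_defl //.
(* Cost and savings add up to the length almost surely; both are nonnegative,
   so their integrals add up as well, and the savings are subtracted. *)
apply/eqP; rewrite -saved_u -ge0_integralD //; first last.
- exact/measurable_EFinP/measurable_stages_saved.
- by move=> w _; rewrite lee_fin stages_saved_ge0.
- exact/measurable_EFinP/measurable_cost.
- by move=> w _; rewrite lee_fin ler0n.
rewrite -[LHS]mule1 -(probability_setT P) -integral_cst //.
apply: ae_eq_integral => //.
  apply: emeasurable_funD; apply/measurable_EFinP; first exact: measurable_cost.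
  exact: measurable_stages_saved.
apply: filterS ae_at_most_one_red => w one_red _ /=.
by rewrite -EFinD /cost cost_add_saved.
Qed.

(** Valid policies are rearrangements of one another, so [expected_cost] turns
    optimality into the maximality of [saving density]. *)
Lemma optimal_sorted u : valid_policy Q u ->
  optimal Q u <-> sorted (fun i j => density j <= density i) u.
Proof.
move=> valid_u; have [size_u count_u] := valid_u.
have cost_le t : valid_policy Q t ->
    ('E_P[cost Q u] <= 'E_P[cost Q t])%E = (saving density t <= saving density u).
  move=> valid_t; rewrite !expected_cost // lee_fin size_u valid_t.1.
  by rewrite lerD2l lerN2.
split=> [[_ u_opt]|u_sorted].
  apply: saving_max_sorted => t eq_ut; have valid_t : valid_policy Q t.
    by split=> [|i]; rewrite -?(perm_size eq_ut) // -(permP eq_ut).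
  by rewrite -cost_le // u_opt.
split=> // t valid_t; rewrite cost_le //; apply: saving_sorted_max => //.
by apply/allP => i _ /=; rewrite count_u valid_t.2.
Qed.

End SingleMarble.

(** * Block policies *)

Lemma valid_block_policy (v : seq V) : uniq v -> size v = #|V| ->
  valid_policy Q (block_policy Q v).
Proof.
move=> uniq_v size_v.
have eq_v : perm_eq v (index_enum V).
  apply: uniq_perm => //; first exact: index_enum_uniq.
  have [_ eq_v] := uniq_min_size uniq_v (fun i _ => mem_enum V i : i \in enum V)
    (eq_leq (esym (etrans size_v (cardE V)))).
  by move=> i; rewrite eq_v mem_enum mem_index_enum.
split=> [|i]; rewrite /block_policy.
  rewrite size_flatten /shape -map_comp sumnE big_map (perm_big _ eq_v) /=.
  by apply: eq_bigr => i _; rewrite size_nseq.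
rewrite count_flatten -map_comp sumnE big_map (perm_big _ eq_v) /=.
rewrite (bigD1 i) //= count_nseq /= eqxx mul1n big1 ?addn0 // => j neq_ji.
by rewrite count_nseq /= (negPf neq_ji).
Qed.

End Search.

Theorem theorem6 (d : measure_display) (T : measurableType d) (R : realType)
    (P : probability T R) (V : finType) (Q : urn_search P V)
    (hQ : single_marble Q) (v : #|V|.-tuple V) (hv : uniq v) :
  optimal Q (block_policy Q v) <->
  forall i j : 'I_#|V|, j = i.+1 :> nat ->
    phi Q [set tnth v i]%SET / (marbles Q (tnth v i))%:R >=
    phi Q [set tnth v j]%SET / (marbles Q (tnth v j))%:R.
Proof.
have valid_v := valid_block_policy Q hv (size_tuple v).
apply: iff_trans (optimal_sorted hQ valid_v) _.
rewrite sorted_flatten_nseq; [|by move=> i; exact: lexx|exact: marbles_gt0].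
have [i0 _] : exists i0 : V, i0 \in V by apply/card_gt0P; exact: urns_nonempty Q.
split=> [/(sortedP i0) v_sorted i j def_j|v_desc].
  rewrite !(tnth_nth i0) def_j.
  by apply: v_sorted; rewrite size_tuple -def_j.
apply/(sortedP i0) => k; rewrite size_tuple => lt_k.
have := v_desc (Ordinal (ltnW lt_k)) (Ordinal lt_k) erefl.
by rewrite !(tnth_nth i0).
Qed.
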